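(* Let $d\ge1$ and let $K$ be a $d$-dimensional simplicial cycle with cyclically ordered facets $F_1,\ldots,F_m$ (indices modulo $m$, $m\ge3$). Put \[ s_i=\left\langle\partial_dF_i,\partial_dF_{i+1}\right\rangle, \qquad \varepsilon(K)=\prod_{i=1}^m s_i . \] Then the equality eigenvalues of $K$, i.e. the positive eigenvalues $\lambda$ of $L^{\mathrm{up}}_{d-1}(K)$ with $m_K(\lambda)=2\theta_d(K)+p_d(K)$, listed without repetition, are \[ \lambda_j=d+1+2\cos\frac{2\pi j}{m}, \qquad 1\le j\le\left\lceil\frac m2\right\rceil-1, \] if $\varepsilon(K)=1$, and \[ \lambda_j=d+1+2\cos\frac{(2j+1)\pi}{m}, \qquad 0\le j\le\left\lfloor\frac m2\right\rfloor-1, \] if $\varepsilon(K)=-1$. Each of them has multiplicity two.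
   Context: A finite abstract simplicial complex $K$ is a collection of subsets (faces) of a finite vertex set closed under taking subsets; a face $\sigma$ has dimension $|\sigma|-1$. $f_i(K)$ is the number of $i$-dimensional faces. Facets are inclusion-maximal faces; $K$ is pure of dimension $d$ if every facet has dimension $d$. A ridge is a $(d-1)$-face. $K$ is ridge-connected if for every two facets $F,F'$ there are facets $F=F_0,F_1,\ldots,F_t=F'$ such that $F_{i-1}$ and $F_i$ share a ridge for each $i$. A ridge is free if it is contained in exactly one facet, otherwise nonfree. A facet is pendant if exactly $d$ of its $d+1$ ridges are free; $p_d(K)$ is the number of pendant facets. Define $\theta_d(K)=d f_d(K)-f_{d-1}(K)+1$. Choose an orientation of every face; $C_i(K;\mathbb{R})$ is the real inner product space with the oriented $i$-faces as orthonormal basis ($\langle\cdot,\cdot\rangle$ is its inner product), and $\partial_i:C_i(K;\mathbb{R})\to C_{i-1}(K;\mathbb{R})$, $\partial_i[v_0,\ldots,v_i]=\sum_{j=0}^i(-1)^j[v_0,\ldots,\widehat{v_j},\ldots,v_i]$, is the boundary operator. In $\partial_d F_i$, the facet $F_i$ stands for its oriented basis chain. The upper Laplacian is $L_{d-1}^{\mathrm{up}}(K)=\partial_d\partial_d^{\mathsf T}$, and for $\lambda>0$, $m_K(\lambda)$ is the multiplicity of $\lambda$ as an eigenvalue of it. A pure ridge-connected $d$-complex $K$ is a simplicial cycle if its facets can be cyclically ordered as $F_1,\ldots,F_m$ with $m\ge 3$, and there are distinct ridges $R_1,\ldots,R_m$ such that, with indices modulo $m$: (1) $R_i=F_i\cap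 F_{i+1}$; (2) $R_i$ is contained in exactly the two facets $F_i$ and $F_{i+1}$; (3) $R_1,\ldots,R_m$ are all the nonfree ridges of $K$. ''Cyclically ordered facets $F_1,\dots,F_m$'' refers to such an ordering. *)

(* Defs.v *)
From mathcomp Require Import all_boot all_order all_fingroup all_algebra.
From mathcomp Require Import reals.

Set Implicit Arguments.
Unset Strict Implicit.
Unset Printing Implicit Defensive.

Import GRing.Theory Num.Theory.
Local Open Scope ring_scope.

Section Complexes.

Variable V : finType.
Implicit Types (K : {set {set V}}) (F G r : {set V}) (d : nat).

Definition simplicial_complex K : Prop :=
  forall s t : {set V}, s \in K -> t \subset s -> t \in K.

(* The empty set is the face of dimension -1 and belongs to no [faces K i]. *)
Definition faces K (i : nat) : {set {set V}} := [set s in K | #|s| == i.+1].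

Definition facets K : {set {set V}} := [set F | maxset (fun s => s \in K) F].

Definition pure K d : Prop := forall F, F \in facets K -> #|F| = d.+1.

(* Meaningful for [0 < d] only. *)
Definition ridges K d : {set {set V}} := faces K d.-1.

Definition facets_containing K r : {set {set V}} :=
  [set F in facets K | r \subset F].

Definition free_ridge K r : bool := #|facets_containing K r| == 1%N.

Definition share_ridge K d : rel {set V} := fun F G =>
  [&& F \in facets K, G \in facets K
    & [exists r in ridges K d, (r \subset F) && (r \subset G)]].

Definition ridge_connected K d : Prop :=
  forall F G, F \in facets K -> G \in facets K -> connect (share_ridge K d) F G.

Definition pendant_facet K d F : bool :=
  (F \in facets K) &&
  (#|[set r in ridges K d | (r \subset F) && free_ridge K r]| == d).

Definition pendant_number K d : nat := #|[set F | pendant_facet K d F]|.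

Definition theta K d : int :=
  (d * #|faces K d|)%N%:Z - #|faces K d.-1|%:Z + 1.

(* Indices are in {0, ..., m-1}, and [ordS i] is i + 1 modulo m. *)
Definition cyclic_facet_ordering K d (m : nat) (F : 'I_m -> {set V}) : Prop :=
  [/\ (3 <= m)%N,
      injective F,
      [set F i | i : 'I_m] = facets K &
      exists r : 'I_m -> {set V},
        [/\ injective r,
            forall i, r i \in ridges K d,
            forall i, r i = F i :&: F (ordS i),
            forall i, facets_containing K (r i) = [set F i; F (ordS i)] &
            [set r i | i : 'I_m] = [set s in ridges K d | ~~ free_ridge K s]]].

Definition simplicial_cycle K d : Prop :=
  [/\ pure K d, ridge_connected K d &
      exists (m : nat) (F : 'I_m -> {set V}), cyclic_facet_ordering K d F].

(* An orientation is given by one representative ordering of each face. *)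
Definition orientation K (o : {set V} -> seq V) : Prop :=
  forall s, s \in K -> perm_eq (o s) (enum s).

End Complexes.

Section Chains.

Variables (R : realType) (V : finType).
Implicit Types (K : {set {set V}}) (o : {set V} -> seq V) (w t : seq V).

(* For duplicate-free [w] and [t], the permutation picked below is unique if it
   exists, so this is the sign of the rearrangement of [w] into [t], and 0 if
   [t] is not a rearrangement of [w]. *)
Definition rearr_sign w t : R :=
  if [pick p : {perm V} | perm_on [set x in w] p && (map p w == t)] is Some p
  then (-1) ^+ odd_perm p else 0.

(* C_i(K; R), in coordinates on the basis of oriented i-faces. *)
Local Notation chain K i := 'cV[R]_#|faces K i|.

Definition chain_inner K i (a b : chain K i) : R := \sum_k a k 0 * b k 0.

(* The chain [w_0, ..., w_i], equal to plus or minus the basis chain of the face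
   with these vertices; in particular [oriented_simplex K i o (o s)] is the
   basis chain of the oriented i-face s. *)
Definition oriented_simplex K i o w : chain K i :=
  \col_k rearr_sign w (o (enum_val k)).

Definition boundary_simplex K i o w : chain K i.-1 :=
  \sum_(j < size w)
    (-1) ^+ j *: oriented_simplex K i.-1 o (take j w ++ drop j.+1 w).

(* The matrix of the boundary operator C_i -> C_(i-1), for [0 < i]. *)
Definition boundary_mx K i o : 'M[R]_(#|faces K i.-1|, #|faces K i|) :=
  \matrix_(k, l) boundary_simplex K i o (o (enum_val l)) k 0.

Definition boundary K i o (a : chain K i) : chain K i.-1 :=
  boundary_mx K i o *m a.

(* L_(d-1)^up *)
Definition upper_laplacian K d o : 'M[R]_#|faces K d.-1| :=
  boundary_mx K d o *m (boundary_mx K d o)^T.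

Definition laplacian_mult K d o (lambda : R) : nat :=
  \rank (eigenspace (upper_laplacian K d o) lambda).

Definition equality_eigenvalue K d o (lambda : R) : Prop :=
  [/\ 0 < lambda,
      eigenvalue (upper_laplacian K d o) lambda &
      (laplacian_mult K d o lambda)%:Z =
        2%:Z * theta K d + (pendant_number K d)%:Z].

Definition facet_sign K d o m (F : 'I_m -> {set V}) (i : 'I_m) : R :=
  chain_inner (boundary o (oriented_simplex K d o (o (F i))))
              (boundary o (oriented_simplex K d o (o (F (ordS i))))).

Definition cycle_sign K d o m (F : 'I_m -> {set V}) : R :=
  \prod_(i < m) facet_sign K d o F i.

End Chains.

(* Main.v *)
Require Import Defs.
From mathcomp Require Import all_boot all_order all_fingroup all_algebra.
From mathcomp Require Import reals trigo.
From mathcomp Require Import ring lra zify.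

(** Let B be the matrix of the boundary operator in degree d.  The upper
    Laplacian B B^T and the Gram matrix B^T B have the same nonzero eigenvalues
    with the same multiplicities ([rank_eigenspace_mulmxC]), and B^T B is much
    simpler: it is indexed by the m facets, its diagonal entries are d + 1
    (a facet has d + 1 ridges, each with coefficient 1 or -1), and two distinct
    facets have inner product 1 or -1 if they are cyclically consecutive, since
    they then share exactly one ridge, and 0 otherwise.  So B^T B is d + 1 plus
    the adjacency matrix of an m-cycle whose edges carry the signs s_i.

    Counting the pairs (ridge, facet containing it) gives m (d + 1) = (number
    of ridges) + m, as exactly m ridges lie in two facets and the others in
    one.  Hence theta is 1.  Every facet has two nonfree ridges, hence no facet
    is pendant, and an equality eigenvalue is a positive eigenvalue of
    multiplicity two.

    The eigenvectors x of the signed cycle are found by unrolling it.  Put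
    y_k = s_0 ... s_(k-1) x_(k mod m).  Then x is an eigenvector for d + 1 + mu
    if and only if y_(k+2) = mu y_(k+1) - y_k for all k, and the gauge change
    has moved all signs into y_(k+m) = e y_k, where e is the product of the
    s_i ([eigenspace_recurrent], [unrollD], [unroll_row]).  A solution is
    determined by y_0 and y_1, so the multiplicity is at most two, and it is
    two exactly when every solution of the recurrence is e-periodic in this
    sense.

    If |mu| >= 2, the solution with y_0 = 0 and y_1 <> 0 grows and never
    returns to 0.  If mu = 2 cos t with 0 < t < pi, the solutions are the
    combinations of cos (k t) and sin (k t), and all of them are e-periodic if
    and only if sin (m t) = 0 and cos (m t) = e, that is, t = k pi / m with
    0 < k < m and (-1)^k = e ([signed_cycle_rank2]).  The even k give the list
    for e = 1 and the odd k the list for e = -1; these angles lie strictly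
    between 0 and pi, where cosine is injective and greater than -1, so the
    eigenvalues are distinct and positive. *)

Set Implicit Arguments.
Unset Strict Implicit.
Unset Printing Implicit Defensive.

Import Order.TTheory GRing.Theory Num.Theory.
Local Open Scope ring_scope.

(** * Signs of rearrangements *)

Section RearrangementSign.
Variables (R : realType) (V : finType).
Implicit Types w t : seq V.

Lemma rearr_sign_eq0 w t :
  [set x in w] != [set x in t] -> rearr_sign R w t = 0.
Proof.
rewrite /rearr_sign; case: pickP => // p /andP[pon /eqP <-] /negP[].
apply/eqP/setP => x; rewrite !inE.
apply/idP/mapP => [xw | [y yw ->]]; last first.
  by have := perm_closed y pon; rewrite !inE yw.
exists (p^-1%g x); last by rewrite permKV.
by have := perm_closed (p^-1%g x) pon; rewrite !inE permKV xw.
Qed.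

(** Sending the i-th entry of w to the i-th entry of t defines a permutation of
    the whole type, because w and t have the same entries; so the sign is not
    the default value 0. *)
Lemma sqr_rearr_sign w t : uniq w -> perm_eq w t -> rearr_sign R w t ^+ 2 = 1.
Proof.
move=> uw wt; have ut : uniq t by rewrite -(perm_uniq wt).
have szwt := perm_size wt.
rewrite /rearr_sign; case: pickP => [p _ | no]; first by rewrite sqrr_sign.
(* Off w the index of x is the size of t, so nth returns its default x. *)
pose f x := nth x t (index x w).
have fin x : x \in w -> f x \in t.
  by move=> xw; rewrite mem_nth // -szwt index_mem.
have fout x : x \notin w -> f x = x.
  by move=> xw; rewrite /f nth_default // -szwt leqNgt index_mem.
have finj : injective f.
  move=> x y; case: (boolP (x \in w)) => xw; case: (boolP (y \in w)) => yw.
  - rewrite /f (set_nth_default x y) -?szwt ?index_mem // => /eqP.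
    rewrite nth_uniq // -?szwt ?index_mem // => /eqP ixy.
    by rewrite -[x](nth_index x xw) ixy nth_index.
  - move=> fxy; have := fin _ xw.
    by rewrite fxy fout // -(perm_mem wt) (negPf yw).
  - move=> fxy; have := fin _ yw.
    by rewrite -fxy fout // -(perm_mem wt) (negPf xw).
  - by rewrite !fout.
have := no (perm finj); case/negP; apply/andP; split.
  apply/subsetP => x; rewrite !inE permE; apply: contraR => xw.
  by rewrite fout.
apply/eqP.
have [/eqP|sw] := posnP (size w); first
  by rewrite size_eq0 => /eqP w0; move: szwt; rewrite w0; case: (t).
have x0 : V by move: sw; case: (w) => // x0.
apply: (@eq_from_nth _ x0); rewrite size_map // => i iw.
rewrite (nth_map x0) // permE /f index_uniq //; apply: set_nth_default.
by rewrite -szwt.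
Qed.

Lemma rearr_sign_id w : uniq w -> rearr_sign R w w = 1.
Proof.
move=> uw; rewrite /rearr_sign; case: pickP => [p /andP[pon /eqP pw] | /(_ 1%g)].
  suff -> : p = 1%g by rewrite odd_perm1.
  apply/permP => x; rewrite perm1; case: (boolP (x \in w)) => xw.
    have : nth x (map p w) (index x w) = x by rewrite pw nth_index.
    by rewrite (nth_map x) ?index_mem // nth_index.
  by rewrite (out_perm pon) // inE.
by rewrite perm_on1 (eq_map (g := id)) ?map_id ?eqxx // => x; rewrite perm1.
Qed.

End RearrangementSign.

(** * Entries of the boundary matrix *)

Lemma perm_delete (T : eqType) (x0 : T) (w : seq T) j :
  (j < size w)%N -> perm_eq w (nth x0 w j :: take j w ++ drop j.+1 w).
Proof.
move=> jw; rewrite -{1}(cat_take_drop j w) (drop_nth x0) //.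
by rewrite -cat1s perm_catCA.
Qed.

Section BoundaryMatrix.
Variables (R : realType) (V : finType) (K : {set {set V}}).
Variables (d : nat) (o : {set V} -> seq V).
Hypothesis ho : orientation K o.

Lemma orientation_uniq s : s \in K -> uniq (o s).
Proof. by move=> sK; rewrite (perm_uniq (ho sK)) enum_uniq. Qed.

Lemma mem_orientation s : s \in K -> o s =i s.
Proof. by move=> sK x; rewrite (perm_mem (ho sK)) mem_enum. Qed.

Lemma orientation_set s : s \in K -> [set x in o s] = s.
Proof. by move=> sK; apply/setP=> x; rewrite inE mem_orientation. Qed.

Lemma size_orientation s : s \in K -> size (o s) = #|s|.
Proof. by move=> sK; rewrite (perm_size (ho sK)) -cardE. Qed.

Lemma face_val i (k : 'I_#|faces K i|) :
  enum_val k \in K /\ #|enum_val k| = i.+1.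
Proof. by have := enum_valP k; rewrite inE => /andP[? /eqP]. Qed.

Lemma oriented_simplex_orientation i (l : 'I_#|faces K i|) :
  oriented_simplex R K i o (o (enum_val l)) = delta_mx l 0.
Proof.
apply/matrixP=> k j; rewrite !mxE ord1 eqxx andbT.
have [kK _] := face_val k; have [lK _] := face_val l.
case: eqP => [-> | /eqP kl]; first by rewrite rearr_sign_id ?orientation_uniq.
rewrite rearr_sign_eq0 // !orientation_set //.
by apply: contra_neq kl => /enum_val_inj.
Qed.

Lemma boundary_orientation (l : 'I_#|faces K d|) :
  boundary o (oriented_simplex R K d o (o (enum_val l)))
    = col l (boundary_mx R K d o).
Proof. by rewrite /boundary oriented_simplex_orientation -colE. Qed.

(** The simplex obtained by deleting one vertex of F rearranges into a given
    ridge for exactly one choice of the vertex if the ridge lies in F, and for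
    none otherwise.  Squares suffice below: orientations only affect signs. *)
Lemma sqr_boundary_mx (hd : (0 < d)%N) k l :
  boundary_mx R K d o k l ^+ 2
    = (enum_val k \subset enum_val l)%:R.
Proof.
have [kK kc] := face_val k; have [lK lc] := face_val l.
rewrite prednK // in kc.
set r := enum_val k in kK kc *; set F := enum_val l in lK lc *.
rewrite mxE /boundary_simplex -/F; set w := o F.
have uw : uniq w by rewrite orientation_uniq.
have sw : size w = d.+1 by rewrite size_orientation.
have wF : [set x in w] = F by rewrite orientation_set.
rewrite summxE.
have nthw (x0 : V) (j : 'I_(size w)) :
    [set x in take j w ++ drop j.+1 w] = F :\ nth x0 w j /\
    uniq (take j w ++ drop j.+1 w).
  have pw := perm_delete x0 (ltn_ord j).
  have := uw; rewrite (perm_uniq pw) /= => /andP[xnot ut]; split=> //.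
  rewrite -wF; apply/setP=> y; rewrite !inE (perm_mem pw) inE.
  by case: eqP => //= ->; apply/negbTE.
have off (x0 : V) (j : 'I_(size w)) : r != F :\ nth x0 w j ->
    ((-1) ^+ j *: oriented_simplex R K d.-1 o (take j w ++ drop j.+1 w)) k 0 = 0.
  have [sj _] := nthw x0 j; move=> rne; rewrite !mxE rearr_sign_eq0 ?mulr0 //.
  by rewrite sj orientation_set // eq_sym.
case: (boolP (r \subset F)) => rF; last first.
  rewrite big1 ?expr0n // => j _; have x0 := tnth (in_tuple w) j.
  by apply: (off x0); apply: contraNneq rF => ->; apply: subD1set.
have /eqP/cards1P[x Frx] : #|F :\: r| = 1%N.
  by rewrite cardsD (setIidPr rF) lc kc subSnn.
have xF : x \in F by have := set11 x; rewrite -Frx inE => /andP[].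
have rE : r = F :\ x.
  by rewrite -Frx setDDr setDv set0U; apply/esym/setIidPr.
have xw : x \in w by rewrite mem_orientation.
have ix : (index x w < size w)%N by rewrite index_mem.
rewrite (bigD1 (Ordinal ix)) //= big1 ?addr0 => [|j jne]; last first.
  apply: (off x); rewrite rE; apply: contra_neq jne => FE.
  apply: val_inj => /=; suff -> : x = nth x w j by rewrite index_uniq.
  apply/eqP; have : (x \in F :\ x) = (x \in F :\ nth x w j) by rewrite {1}FE.
  rewrite !inE eqxx xF !andbT /=.
  by move/esym/negbFE.
have [sj uj] := nthw x (Ordinal ix); rewrite /= nth_index // -rE in sj uj.
rewrite !mxE exprMn sqrr_sign mul1r sqr_rearr_sign // uniq_perm ?orientation_uniq //.
by move=> y; rewrite -/r mem_orientation // -sj inE.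
Qed.

End BoundaryMatrix.

(** * Facets and ridges of a simplicial cycle *)

Lemma ordS_neq m (i : 'I_m) : (1 < m)%N -> ordS i != i.
Proof.
move=> m1; apply/eqP => /(congr1 val) /=.
have [lt | ge] := ltnP i.+1 m; first
  by rewrite modn_small // => /eqP; rewrite (gtn_eqF (ltnSn _)).
have -> : i.+1 = m by apply/eqP; rewrite eqn_leq ltn_ord.
by rewrite modnn => i0; move: ge; rewrite -i0 leqNgt m1.
Qed.

(** Together with [ordS_neq], this is where m >= 3 enters: the two cyclic
    neighbours of a facet are different. *)
Lemma ordSS_neq m (i : 'I_m) : (2 < m)%N -> ordS (ordS i) != i.
Proof.
move=> m2; apply/eqP => /(congr1 val) /=.
rewrite -addn1 modnDml addn1.
have [lt | ge] := ltnP i.+2 m.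
  by rewrite modn_small // => /eqP; rewrite (gtn_eqF (ltnW (ltnSn _))).
have [-> | ne] := eqVneq i.+2 m.
  by rewrite modnn => i0; move: ge; rewrite -i0 leqNgt m2.
have im : i.+1 = m.
  by apply/eqP; rewrite eqn_leq ltn_ord /= -ltnS ltn_neqAle eq_sym ne ge.
rewrite im -addn1 modnDl modn_small 1?ltnW // => i1.
by move: m2; rewrite -im -i1.
Qed.

Section FacetsOfCycle.
Variables (R : realType) (V : finType) (K : {set {set V}}) (d m : nat).
Variables (F : 'I_m -> {set V}).
Hypotheses (hd : (0 < d)%N) (hK : simplicial_complex K) (hpure : pure K d).
Hypothesis hF : cyclic_facet_ordering K d F.

Definition common_ridge i := F i :&: F (ordS i).

Lemma faces_pure : faces K d = facets K.
Proof.
apply/setP=> s; rewrite !inE; apply/andP/idP => [[sK /eqP sc] | smax].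
  have [G Gmax sG] := maxset_exists (P := fun s => s \in K) sK.
  suff -> : s = G by [].
  apply/eqP; rewrite eqEcard sG sc hpure ?leqnn //.
  by rewrite inE.
by split; [exact: maxsetp smax | rewrite hpure // inE].
Qed.

Lemma cycle_length : (2 < m)%N. Proof. by case: hF. Qed.

Lemma facet_inj : injective F. Proof. by case: hF. Qed.

Lemma facets_cycle : facets K = F @: setT.
Proof.
case: hF => _ _ <- _; apply/setP=> G.
by apply/imsetP/imsetP => -[i _ ->]; exists i.
Qed.

Lemma facet_mem i : F i \in facets K.
Proof. by rewrite facets_cycle imset_f. Qed.

Lemma facet_face i : F i \in K.
Proof. by have := facet_mem i; rewrite inE => /maxsetp. Qed.

Lemma facet_neq i : F (ordS i) != F i.
Proof. by rewrite (inj_eq facet_inj) ordS_neq // ltnW // cycle_length. Qed.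

Lemma common_ridge_inj : injective common_ridge.
Proof.
by case: hF => _ _ _ [r [rinj _ rE _ _]] i j; rewrite /common_ridge -!rE => /rinj.
Qed.

Lemma common_ridge_mem i : common_ridge i \in ridges K d.
Proof. by case: hF => _ _ _ [r [_ rr rE _ _]]; rewrite /common_ridge -rE. Qed.

Lemma common_ridge_facets i :
  facets_containing K (common_ridge i) = [set F i; F (ordS i)].
Proof. by case: hF => _ _ _ [r [_ _ rE rf _]]; rewrite /common_ridge -rE rf. Qed.

Lemma nonfree_common_ridge s : s \in ridges K d -> ~~ free_ridge K s ->
  exists i, s = common_ridge i.
Proof.
case: hF => _ _ _ [r [_ _ rE _ rn]] sr sn.
have : s \in [set s in ridges K d | ~~ free_ridge K s] by rewrite inE sr.
by rewrite -rn => /imsetP[i _ ->]; exists i; rewrite rE.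
Qed.

Lemma common_ridge_nonfree i : ~~ free_ridge K (common_ridge i).
Proof. by rewrite /free_ridge common_ridge_facets cards2 [F i == _]eq_sym facet_neq. Qed.

(** A ridge in two facets is nonfree, so it is one of the m listed ridges, and
    these lie in two consecutive facets only. *)
Lemma shared_ridge s i j : s \in ridges K d -> i != j ->
  s \subset F i -> s \subset F j ->
  (j = ordS i /\ s = common_ridge i) \/ (i = ordS j /\ s = common_ridge j).
Proof.
move=> sr ij si sj.
have Fin l : s \subset F l -> F l \in facets_containing K s.
  by move=> sl; rewrite inE facet_mem.
have sn : ~~ free_ridge K s.
  apply/negP => /cards1P[G GE]; have := Fin _ si; have := Fin _ sj.
  rewrite GE !inE => /eqP <- /eqP /facet_inj ijE.
  by rewrite ijE eqxx in ij.
have [k sE] := nonfree_common_ridge sr sn.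
have := Fin _ si; have := Fin _ sj.
rewrite sE common_ridge_facets !inE !(inj_eq facet_inj).
case/orP => /eqP jE; case/orP => /eqP iE; rewrite ?jE ?iE ?eqxx // in ij *.
- by right.
- by left.
Qed.

Lemma card_ridges_in_facet i :
  #|[set r in ridges K d | r \subset F i]| = d.+1.
Proof.
have -> : [set r in ridges K d | r \subset F i]
        = [set r : {set V} | r \subset F i & #|r| == d].
  apply/setP=> r; rewrite !inE prednK //.
  case: (boolP (r \subset F i)) => rF; rewrite ?andbF ?andbT //=.
  by rewrite (hK (facet_face i) rF).
by rewrite cards_draws hpure ?facet_mem // binSn.
Qed.

Lemma card_facets_containing s : s \in ridges K d ->
  #|facets_containing K s| = (1 + ~~ free_ridge K s)%N.
Proof.
move=> sr; case: (boolP (free_ridge K s)) => [/eqP -> // | sn].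
have [i ->] := nonfree_common_ridge sr sn.
by rewrite common_ridge_facets cards2 [F i == _]eq_sym facet_neq.
Qed.

Lemma card_facets_cycle : #|facets K| = m.
Proof. by rewrite facets_cycle card_imset ?cardsT ?card_ord //; exact: facet_inj. Qed.

Lemma card_nonfree : #|[set s in ridges K d | ~~ free_ridge K s]| = m.
Proof.
have -> : [set s in ridges K d | ~~ free_ridge K s] = common_ridge @: setT.
  apply/setP=> s; rewrite inE; apply/andP/imsetP => [[sr sn] | [i _ ->]].
    by have [i ->] := nonfree_common_ridge sr sn; exists i.
  by rewrite common_ridge_mem common_ridge_nonfree.
by rewrite card_imset ?cardsT ?card_ord //; exact: common_ridge_inj.
Qed.

(** Double counting of the pairs formed by a ridge and a facet containing it;
    the m nonfree ridges are counted twice. *)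
Lemma card_ridges : (#|ridges K d| + m = m * d.+1)%N.
Proof.
have <- : (\sum_(s in ridges K d) #|facets_containing K s| = m * d.+1)%N.
  rewrite -[in RHS]card_facets_cycle -sum_nat_const.
  under eq_bigr do rewrite -sum1_card.
  rewrite (exchange_big_dep (mem (facets K))) /= => [|s G _]; last first.
    by rewrite inE => /andP[].
  apply: eq_bigr => G Gf; rewrite sum1dep_card.
  have /imsetP[i _ GE] : G \in F @: setT by rewrite -facets_cycle.
  rewrite GE -(card_ridges_in_facet i); apply: eq_card => s.
  by rewrite !inE -GE; move: Gf; rewrite inE => ->.
rewrite (eq_bigr _ (fun s sr => card_facets_containing sr)) big_split /= sum1_card.
congr addn; rewrite -{1}card_nonfree -sum1dep_card big_mkcondr /=.
by apply: eq_bigr => s _; case: free_ridge.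
Qed.

Lemma theta_cycle : theta K d = 1.
Proof.
rewrite /theta faces_pure card_facets_cycle.
have /eqP := card_ridges; rewrite mulnS addnC eqn_add2l => /eqP.
by rewrite /ridges => ->; rewrite mulnC subrr add0r.
Qed.

(** The ridges shared with the previous and the next facet are distinct and
    nonfree, which leaves at most d - 1 free ridges in a facet. *)
Lemma pendant_number_cycle : pendant_number K d = 0%N.
Proof.
apply/eqP; rewrite cards_eq0; apply/eqP/setP=> G; rewrite !inE.
apply/negP => /andP[]; rewrite facets_cycle => /imsetP[j _ ->].
rewrite -(ord_predK j); set i := ord_pred j.
apply/negP; rewrite neq_ltn; apply/orP; left.
have := card_ridges_in_facet (ordS i).
rewrite -(cardsID [set s | free_ridge K s]) => cE.
set A := [set s in ridges K d | s \subset F (ordS i)] in cE.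
have sub : [set common_ridge i; common_ridge (ordS i)]
    \subset A :\: [set s | free_ridge K s].
  apply/subsetP=> s; rewrite !inE.
  case/orP=> /eqP ->; rewrite common_ridge_nonfree.
  - by have := common_ridge_mem i; rewrite !inE subsetIr => ->.
  - by have := common_ridge_mem (ordS i); rewrite !inE subsetIl => ->.
have := subset_leq_card sub.
rewrite cards2 (inj_eq common_ridge_inj) eq_sym ordS_neq; last first.
  by rewrite ltnW // cycle_length.
rewrite -(leq_add2l #|A :&: [set s | free_ridge K s]|) cE addn2 ltnS.
apply: leq_trans; rewrite ltnS subset_leq_card //.
by apply/subsetP=> s; rewrite !inE => /and3P[-> -> ->].
Qed.

(** * The Gram matrix of the facet boundaries *)

Section Gram.
Variable o : {set V} -> seq V.
Hypothesis ho : orientation K o.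

(** The boundary matrix with its columns in the cyclic order of the facets
    instead of the enumeration order of the d-faces. *)
Definition facet_boundary_mx : 'M[R]_(#|faces K d.-1|, m) :=
  \matrix_(k, i) boundary o (oriented_simplex R K d o (o (F i))) k 0.

Definition facet_gram : 'M[R]_m := facet_boundary_mx^T *m facet_boundary_mx.

Lemma facet_gramE i j : facet_gram i j =
  chain_inner (boundary o (oriented_simplex R K d o (o (F i))))
              (boundary o (oriented_simplex R K d o (o (F j)))).
Proof. by rewrite mxE; apply: eq_bigr => k _; rewrite !mxE. Qed.

Lemma facet_index i : {l : 'I_#|faces K d| | enum_val l = F i}.
Proof.
have Fi : F i \in faces K d by rewrite faces_pure facet_mem.
by exists (enum_rank_in Fi (F i)); rewrite enum_rankK_in.
Qed.

Lemma facet_boundary_mxE k i l : enum_val l = F i ->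
  facet_boundary_mx k i = boundary_mx R K d o k l.
Proof.
by move=> lE; rewrite mxE -lE boundary_orientation // mxE.
Qed.

Lemma upper_laplacian_facets :
  upper_laplacian R K d o = facet_boundary_mx *m facet_boundary_mx^T.
Proof.
apply/matrixP=> k k'; rewrite !mxE.
pose h i := sval (facet_index i).
have hE i : enum_val (h i) = F i by rewrite /h; case: facet_index.
have hinj : injective h by move=> i j hij; apply: facet_inj; rewrite -!hE hij.
have hbij : bijective h.
  apply: inj_card_bij => //; rewrite !card_ord faces_pure card_facets_cycle.
  by [].
rewrite (reindex h) /=; last exact: onW_bij.
by apply: eq_bigr => i _; rewrite ![(_^T)%R _ _]mxE -!(facet_boundary_mxE _ (hE i)).
Qed.

Lemma sqr_facet_boundary_mx (k : 'I_#|faces K d.-1|) i :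
  facet_boundary_mx k i ^+ 2 = (enum_val k \subset F i)%:R.
Proof.
by have [l lE] := facet_index i; rewrite (facet_boundary_mxE _ lE) sqr_boundary_mx ?lE.
Qed.

Lemma facet_boundary_mx_eq0 (k : 'I_#|faces K d.-1|) i :
  ~~ (enum_val k \subset F i) -> facet_boundary_mx k i = 0.
Proof.
move=> /negPf ki; apply/eqP; rewrite -sqrf_eq0 sqr_facet_boundary_mx ki.
by [].
Qed.

Lemma facet_gram_sym i j : facet_gram i j = facet_gram j i.
Proof. by rewrite !facet_gramE; apply: eq_bigr => k _; rewrite mulrC. Qed.

Lemma facet_gram_diag i : facet_gram i i = d%:R + 1.
Proof.
rewrite mxE; under eq_bigr do rewrite mxE -expr2 sqr_facet_boundary_mx.
rewrite -(big_enum_val (fun r : {set V} => (r \subset F i)%:R : R)) /=.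
rewrite -natr_sum -big_mkcondr /= sum1dep_card.
by rewrite natr1 card_ridges_in_facet.
Qed.

(** Facets that are not consecutive share no ridge, so in each term of the inner
    product one of the factors vanishes. *)
Lemma facet_gram_off i j : i != j -> j != ordS i -> i != ordS j ->
  facet_gram i j = 0.
Proof.
move=> ij ji ij'; rewrite mxE big1 // => k _; rewrite mxE.
case: (boolP (enum_val k \subset F i)) => ki; last first.
  by rewrite facet_boundary_mx_eq0 ?mul0r.
case: (boolP (enum_val k \subset F j)) => kj; last first.
  by rewrite [X in _ * X]facet_boundary_mx_eq0 ?mulr0.
have := shared_ridge (enum_valP k) ij ki kj.
by case=> [[/eqP] | [/eqP]]; rewrite (negPf ji, negPf ij').
Qed.

(** Only the unique common ridge contributes to the inner product, by a product
    of two signs; this needs that the pair of facets is consecutive in one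
    direction only. *)
Lemma sqr_facet_gram_next i : facet_gram i (ordS i) ^+ 2 = 1.
Proof.
have [k kE] : {k : 'I_#|faces K d.-1| | enum_val k = common_ridge i}.
  have ri : common_ridge i \in faces K d.-1 := common_ridge_mem i.
  by exists (enum_rank_in ri (common_ridge i)); rewrite enum_rankK_in.
rewrite mxE (bigD1 k) //= big1 ?addr0 => [|l lk].
  by rewrite mxE exprMn !sqr_facet_boundary_mx kE subsetIl subsetIr mulr1.
rewrite mxE.
case: (boolP (enum_val l \subset F i)) => li; last first.
  by rewrite facet_boundary_mx_eq0 ?mul0r.
case: (boolP (enum_val l \subset F (ordS i))) => lj; last first.
  by rewrite [X in _ * X]facet_boundary_mx_eq0 ?mulr0.
have ne : i != ordS i by rewrite eq_sym ordS_neq // ltnW // cycle_length.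
case: (shared_ridge (enum_valP l) ne li lj) => [[_ lE] | [/esym/eqP]].
  by case/eqP: lk; apply: enum_val_inj; rewrite lE.
by rewrite (negPf (ordSS_neq _ cycle_length)).
Qed.

End Gram.
End FacetsOfCycle.

(** * Eigenspaces of A B and B A *)

(** Multiplication by A maps the eigenspace of A B into that of B A, and it is
    injective there because a further multiplication by B scales by l <> 0. *)
Lemma rank_eigenspace_mulmxC (F : fieldType) n p (A : 'M[F]_(n, p))
    (B : 'M[F]_(p, n)) (l : F) : l != 0 ->
  \rank (eigenspace (A *m B) l) = \rank (eigenspace (B *m A) l).
Proof.
move=> l0; apply/eqP; rewrite eqn_leq.
suff le n' p' (C : 'M[F]_(n', p')) (D : 'M[F]_(p', n')) :
    (\rank (eigenspace (C *m D) l) <= \rank (eigenspace (D *m C) l))%N.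
  by rewrite !le.
set E := eigenspace (C *m D) l.
have eE : E *m (C *m D) = l *: E by apply/eigenspaceP.
apply: (@leq_trans (\rank (E *m C))).
  by rewrite -(eqmx_scale E l0) -eE mulmxA mxrankM_maxl.
apply: mxrankS; apply/eigenspaceP.
by rewrite mulmxA -(mulmxA E) eE scalemxAl.
Qed.

(** * The recurrence y_(k+2) = mu y_(k+1) - y_k *)

Section Recurrence.
Variable R : realType.
Implicit Types (mu x t : R) (y z : nat -> R).

Definition recurrent mu y := forall k, y k.+2 = mu * y k.+1 - y k.

Lemma recurrent_uniq mu y z : recurrent mu y -> recurrent mu z ->
  y 0 = z 0 -> y 1%N = z 1%N -> y =1 z.
Proof.
move=> ry rz y0 y1 k; suff [] : y k = z k /\ y k.+1 = z k.+1 by [].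
elim: k => [|k [ek ek1]]; first by [].
by split; rewrite // ry rz ek ek1.
Qed.

(** The absolute values are strictly increasing, since
    |y_(k+2)| >= 2 |y_(k+1)| - |y_k|. *)
Lemma recurrent_growth mu y : recurrent mu y -> 2 <= `|mu| ->
  y 0 = 0 -> y 1%N != 0 -> forall k, (0 < k)%N -> y k != 0.
Proof.
move=> ry mu2 y0 y1.
have step k : `|y k| < `|y k.+1|.
  elim: k => [|k IH]; first by rewrite y0 normr0 normr_gt0.
  rewrite ry; have h1 := lerB_dist (mu * y k.+1) (y k).
  have h2 := ler_wpM2r (normr_ge0 (y k.+1)) mu2.
  rewrite -normrM in h2; lra.
by case=> // k _; rewrite -normr_gt0; apply: le_lt_trans (step k).
Qed.

Lemma recurrent_trig (p q t : R) :
  recurrent (2 * cos t) (fun k => p * cos (k%:R * t) + q * sin (k%:R * t)).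
Proof.
move=> k; have -> : k.+2%:R * t = k.+1%:R * t + t by rewrite -[in LHS]natr1; ring.
have -> : k%:R * t = k.+1%:R * t - t by rewrite -natr1; ring.
by rewrite cosD sinD cosB sinB; ring.
Qed.

Lemma cos_natpi k : cos (k%:R * pi) = (-1) ^+ k :> R.
Proof.
have := alternatingn (@cosDpi R) k 0.
by rewrite add0r cos0 mulr1 mulr_natl => ->.
Qed.

Lemma sin_natpi k : sin (k%:R * pi) = 0 :> R.
Proof.
have := alternatingn (@sinDpi R) k 0.
by rewrite add0r sin0 mulr0 mulr_natl => ->.
Qed.

Lemma sin_eq0_natpi x : 0 <= x -> sin x = 0 -> exists k, x = k%:R * pi.
Proof.
move=> x0 sx; have pi0 := pi_gt0 R.
have /truncn_itv : 0 <= x / pi by rewrite divr_ge0 // ltW.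
set k := Num.trunc _; rewrite ler_pdivlMr // ltr_pdivrMr // -natr1 mulrDl mul1r.
case/andP => le lt; exists k.
apply/eqP; rewrite -subr_eq0; apply/eqP.
have := alternatingn (@sinDpi R) k (x - k%:R * pi).
rewrite -[pi *+ k]mulr_natl subrK sx => /esym/eqP.
rewrite mulf_eq0 signr_eq0 /= => /eqP s0.
apply/eqP; rewrite eq_le subr_ge0 le andbT leNgt; apply/negP => gt.
have := @sin_gt0_pi R (x - k%:R * pi).
by rewrite gt s0 ltxx ltrBlDl lt => /(_ isT).
Qed.

Lemma angle_in_0pi m k : (0 < k < m)%N -> 0 < (k%:R * pi / m%:R : R) < pi.
Proof.
case/andP=> k0 km; have m0 : (0 < m%:R :> R) by rewrite ltr0n (leq_ltn_trans _ km).
have pi0 := pi_gt0 R.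
apply/andP; split; first by rewrite divr_gt0 // mulr_gt0 // ltr0n.
rewrite ltr_pdivrMr // mulrC.
by rewrite ltr_pM2l // ltr_nat.
Qed.

(** The single solution vanishing at 0 decides the question: up to scaling it is
    sin (k t) / sin t, and its values at m and m + 1 determine sin (m t) and
    cos (m t). *)
Lemma recurrent_full_period mu e y m : (0 < m)%N ->
  recurrent mu y -> y 0 = 0 -> y 1%N != 0 ->
  (forall k, y (k + m)%N = e * y k) ->
  exists k, [/\ (0 < k < m)%N, (-1) ^+ k = e
             & mu = 2 * cos (k%:R * pi / m%:R)].
Proof.
move=> m0 ry y0 y1 yp.
have ym : y m = 0 by have := yp 0; rewrite add0n y0 mulr0.
have mu2 : `|mu| < 2.
  rewrite ltNge; apply/negP => mu2.
  by have := recurrent_growth ry mu2 y0 y1 m0; rewrite ym eqxx.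
have {mu2} : -1 < mu / 2 < 1 by move: mu2; rewrite ltr_norml; lra.
case/andP=> muN1 mu1; set t := acos (mu / 2).
have t0 : 0 < t by apply: acos_gt0; rewrite ltW.
have tpi : t < pi by apply: acos_ltpi; rewrite muN1 ltW.
have muE : mu = 2 * cos t by rewrite /t acosK ?in_itv /= ?ltW //; lra.
have st : sin t != 0 by rewrite gt_eqF // sin_gt0_pi // t0.
have yE : y =1 fun k => 0 * cos (k%:R * t) + (y 1%N / sin t) * sin (k%:R * t).
  apply: (recurrent_uniq ry); rewrite ?muE; first exact: recurrent_trig.
    by rewrite y0 !mul0r sin0 mulr0 addr0.
  by rewrite !mul1r mul0r add0r divfK.
have smt : sin (m%:R * t) = 0.
  move/eqP: ym; rewrite yE mul0r add0r !mulf_eq0 invr_eq0 (negPf y1) (negPf st).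
  by move=> /eqP.
have cmt : cos (m%:R * t) = e.
  have := yp 1%N; rewrite yE mul0r add0r natrD mulrDl sinD smt mulr0 addr0 mul1r.
  rewrite mulrA divfK // mulrC => h; exact: (mulIf y1).
have mR : 0 < m%:R :> R by rewrite ltr0n.
have [|k kE] := sin_eq0_natpi _ smt; first by rewrite mulr_ge0 ?ltW.
exists k; have tE : t = k%:R * pi / m%:R by rewrite -kE mulrC mulKf ?gt_eqF.
split; last by rewrite -tE.
- have pi0 := pi_gt0 R; rewrite -!(ltr_nat R) -(ltr_pM2r pi0) -kE.
  by rewrite -[_ < _%:R](ltr_pM2r pi0) -kE mul0r mulr_gt0 //= ltr_pM2l.
- by rewrite -cos_natpi -kE.
Qed.

End Recurrence.

(** * Eigenspaces of a signed cycle *)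

Section SignedCycle.
Variables (R : realType) (m : nat) (G : 'M[R]_m) (a : R).
Hypothesis m2 : (2 < m)%N.
Hypothesis Gsym : forall i j, G i j = G j i.
Hypothesis Gdiag : forall i, G i i = a.
Hypothesis Goff :
  forall i j, i != j -> j != ordS i -> i != ordS j -> G i j = 0.
Hypothesis Gsign : forall i, G i (ordS i) ^+ 2 = 1.

Let m0 : (0 < m)%N. Proof. exact: leq_trans m2. Qed.

Definition idx k : 'I_m := Ordinal (ltn_pmod k m0).

Lemma idxS k : idx k.+1 = ordS (idx k).
Proof. by apply: val_inj; rewrite /= -[in RHS]addn1 modnDml addn1. Qed.

Lemma idxD k : idx (k + m) = idx k.
Proof. by apply: val_inj; rewrite /= modnDr. Qed.

Lemma idx_ord (i : 'I_m) : idx i = i.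
Proof. by apply: val_inj; rewrite /= modn_small. Qed.

(** The only invariant of the edge signs under changing the signs of basis
    vectors. *)
Definition holonomy : R := \prod_i G i (ordS i).
Definition gauge k : R := \prod_(i < k) G (idx i) (ordS (idx i)).
(** The lift of a vector to the universal cover of the cycle, with signs chosen
    so that all edges of the cover become positive. *)
Definition unroll (x : 'rV[R]_m) k : R := gauge k * x 0 (idx k).

Lemma gaugeS k : gauge k.+1 = gauge k * G (idx k) (ordS (idx k)).
Proof. by rewrite /gauge big_ord_recr. Qed.

Lemma gauge0 : gauge 0 = 1. Proof. by rewrite /gauge big_ord0. Qed.

Lemma sqr_gauge k : gauge k ^+ 2 = 1.
Proof. by rewrite -prodrXl big1. Qed.

Lemma gauge_neq0 k : gauge k != 0.
Proof. by rewrite -sqrf_eq0 sqr_gauge oner_eq0. Qed.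

Lemma gaugeD k : gauge (k + m) = holonomy * gauge k.
Proof.
elim: k => [|k IH].
  by rewrite gauge0 mulr1; apply: eq_bigr => i _; rewrite idx_ord.
by rewrite addSn !gaugeS IH idxD mulrA.
Qed.

Lemma unrollD x k : unroll x (k + m) = holonomy * unroll x k.
Proof. by rewrite /unroll gaugeD idxD mulrA. Qed.

(** The entry is taken at a successor, so that no predecessor appears. *)
Lemma mulmx_signed_cycle (x : 'rV[R]_m) i :
  (x *m G) 0 (ordS i) =
    x 0 i * G i (ordS i) + a * x 0 (ordS i)
    + x 0 (ordS (ordS i)) * G (ordS i) (ordS (ordS i)).
Proof.
have m1 := ltnW m2.
rewrite mxE (bigD1 i) //= (bigD1 (ordS i)) /=; last exact: ordS_neq.
rewrite (bigD1 (ordS (ordS i))) /=; last by rewrite ordSS_neq // ordS_neq.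
rewrite big1 => [|j /andP[/andP[ji j1] j2]].
  by rewrite Gdiag [G (ordS (ordS i)) _]Gsym; ring.
rewrite Goff ?mulr0 // eq_sym.
by rewrite (inj_eq (can_inj (@ordSK m))).
Qed.

Lemma gauge_mulmx (x : 'rV[R]_m) k :
  gauge k.+1 * (x *m G) 0 (idx k.+1) =
    unroll x k + a * unroll x k.+1 + unroll x k.+2.
Proof.
rewrite /unroll [gauge k.+2]gaugeS !idxS mulmx_signed_cycle.
have := Gsign (idx k); rewrite [gauge k.+1]gaugeS; set s := G (idx k) _ => s2.
have -> : gauge k * x 0 (idx k) = gauge k * s ^+ 2 * x 0 (idx k) by rewrite s2 mulr1.
by ring.
Qed.

Lemma eigenspace_recurrent mu (x : 'rV[R]_m) :
  (x <= eigenspace G (a + mu))%MS <-> recurrent mu (unroll x).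
Proof.
split=> [/eigenspaceP xG k | rx].
  by have := gauge_mulmx x k; rewrite xG mxE /unroll; lra.
apply/eigenspaceP/rowP => j; rewrite -(ord_predK j) -[ord_pred j]idx_ord -idxS.
apply: (mulfI (gauge_neq0 (ord_pred j).+1)).
by rewrite gauge_mulmx rx mxE /unroll; ring.
Qed.

(** The gauge is its own inverse, so every holonomy-periodic sequence is the
    lift of a vector. *)
Lemma unroll_row y : (forall k, y (k + m)%N = holonomy * y k) ->
  unroll (\row_i (gauge i * y i)) =1 y.
Proof.
move=> yp k; elim/ltn_ind: k => k IH.
have [km | mk] := ltnP k m.
  by rewrite /unroll mxE /= modn_small // mulrA -expr2 sqr_gauge mul1r.
by rewrite -(subnK mk) unrollD IH ?yp // ltn_subrL m0 (leq_trans m0 mk).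
Qed.

(** Right multiplication by this matrix keeps the coordinates 0 and 1, that is,
    the initial data of the recurrence. *)
Definition initial_mx : 'M[R]_(m, 2) := \matrix_(i, j) (i == idx j)%:R.

Lemma mul_initial_mx (x : 'rV[R]_m) j : (x *m initial_mx) 0 j = x 0 (idx j).
Proof.
rewrite mxE (bigD1 (idx j)) //= big1 ?addr0 => [|i ij]; rewrite mxE ?eqxx ?mulr1 //.
by rewrite (negPf ij) mulr0.
Qed.

(** A solution of the recurrence with zero initial data vanishes. *)
Lemma rank_initial mu :
  \rank (eigenspace G (a + mu) *m initial_mx) = \rank (eigenspace G (a + mu)).
Proof.
apply/mxrank_injP/rowV0P => x; rewrite sub_capmx => /andP[/eigenspace_recurrent rx].
rewrite sub_kermx => /eqP x0.
have xi j : x 0 (idx (j : 'I_2)) = 0 by rewrite -mul_initial_mx x0 mxE.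
have un : unroll x =1 fun=> 0.
  apply: (recurrent_uniq rx) => [k | | ]; first by rewrite mulr0 subr0.
    by rewrite /unroll (xi 0) mulr0.
  by rewrite /unroll (xi 1) mulr0.
apply/rowP => i; rewrite mxE; have /eqP := un i.
by rewrite /unroll idx_ord mulf_eq0 (negPf (gauge_neq0 _)) => /eqP.
Qed.

(** By [rank_initial], the rank is two exactly when all initial data occur.  In
    one direction the initial data (0, 1) already force mu; in the other, a
    combination of cosine and sine realizes each row of the identity. *)
Lemma signed_cycle_rank2 l :
  \rank (eigenspace G l) = 2%N <->
  exists k, [/\ (0 < k < m)%N, (-1) ^+ k = holonomy
             & l = a + 2 * cos (k%:R * pi / m%:R)].
Proof.
have [mu ->] : exists mu, l = a + mu by exists (l - a); rewrite addrC subrK.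
rewrite -rank_initial; split=> [rk | [k [km ke /addrI ->]]].
  have full : row_full (eigenspace G (a + mu) *m initial_mx) by rewrite /row_full rk.
  have /submxP[D DE] := submx_full (delta_mx 0 1 : 'rV[R]_2) full.
  rewrite mulmxA in DE; set x := D *m _ in DE.
  have xi (j : 'I_2) : x 0 (idx j) = (j == 1)%:R.
    by rewrite -mul_initial_mx -DE mxE eqxx.
  have /eigenspace_recurrent rx : (x <= eigenspace G (a + mu))%MS by apply: submxMl.
  have [||k [km ke ->]] := recurrent_full_period m0 rx _ _ (unrollD x).
  - by rewrite /unroll (xi 0) mulr0.
  - by rewrite /unroll (xi 1) mulr1 gauge_neq0.
  - by exists k.
set t := k%:R * pi / m%:R.
have st : sin t != 0 by rewrite gt_eqF // sin_gt0_pi // angle_in_0pi.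
have mt : m%:R * t = k%:R * pi by rewrite mulrC divfK // pnatr_eq0 gtn_eqF.
apply/eqP; rewrite eqn_leq rank_leq_col -{1}(mxrank1 R 2) mxrankS //.
apply/row_subP => j; set v := row j 1%:M.
(* p and q solve y 0 = v 0 0 and y 1 = gauge 1 * v 0 1, as the entry of x at 1
   is gauge 1 * y 1. *)
pose p := v 0 0; pose q := (gauge 1 * v 0 1 - p * cos t) / sin t.
pose y n := p * cos (n%:R * t) + q * sin (n%:R * t).
have yp n : y (n + m)%N = holonomy * y n.
  by rewrite /y natrD mulrDl mt cosD sinD cos_natpi sin_natpi ke; ring.
set x := \row_(i < m) (gauge i * y i).
have rx : (x <= eigenspace G (a + 2 * cos t))%MS.
  by apply/eigenspace_recurrent => n; rewrite !(unroll_row yp); exact: recurrent_trig.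
suff -> : v = x *m initial_mx by rewrite submxMr.
apply/rowP => i; rewrite mul_initial_mx; apply: (mulfI (gauge_neq0 i)).
rewrite -/(unroll x i) unroll_row //.
case: i => -[|[|//]] i2; rewrite /y /=.
- by rewrite gauge0 mul0r cos0 sin0 mulr0 addr0 mulr1 mul1r; congr (v 0 _); exact: val_inj.
- rewrite mul1r /q divfK // addrC subrK; congr (_ * v 0 _); exact: val_inj.
Qed.

End SignedCycle.

(** * The spectrum of a simplicial cycle *)

Section CycleSpectrum.
Variables (R : realType) (V : finType) (K : {set {set V}}) (d : nat).
Variables (o : {set V} -> seq V) (m : nat) (F : 'I_m -> {set V}).
Hypotheses (hd : (0 < d)%N) (hK : simplicial_complex K) (hpure : pure K d).
Hypotheses (ho : orientation K o) (hF : cyclic_facet_ordering K d F).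

Definition cosine_eigenvalue k : R := d%:R + 1 + 2 * cos (k%:R * pi / m%:R).

Lemma laplacian_mult2P (l : R) : l != 0 ->
  laplacian_mult K d o l = 2%N <->
  exists k, [/\ (0 < k < m)%N, (-1) ^+ k = cycle_sign R K d o F
             & l = cosine_eigenvalue k].
Proof.
move=> l0; rewrite /laplacian_mult (upper_laplacian_facets R hpure hF ho).
rewrite rank_eigenspace_mulmxC // -/(facet_gram R K d F o).
have -> : cycle_sign R K d o F = holonomy (facet_gram R K d F o).
  by apply: eq_bigr => i _; rewrite facet_gramE.
apply: signed_cycle_rank2.
- exact: cycle_length hF.
- exact: facet_gram_sym.
- by move=> i; rewrite (facet_gram_diag R hd hK hpure hF ho).
- exact: (facet_gram_off R hd hpure hF ho).
- exact: (sqr_facet_gram_next R hd hpure hF ho).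
Qed.

Lemma cosine_eigenvalue_gt0 k : (0 < k < m)%N -> 0 < cosine_eigenvalue k.
Proof.
move=> /angle_in_0pi-/(_ R) /andP[t0 tpi]; rewrite /cosine_eigenvalue.
have pi0 := pi_ge0 R.
have : cos pi < cos (k%:R * pi / m%:R) :> R.
  by rewrite ltr_cos // in_itv /= ?pi0 ?lexx // !ltW.
rewrite cospi; have : 1 <= d%:R :> R by rewrite ler1n.
lra.
Qed.

Lemma cosine_eigenvalue_inj :
  {in [pred k | (0 < k < m)%N] &, injective cosine_eigenvalue}.
Proof.
move=> k k' /[!inE] km km' /addrI /mulfI.
have /andP[t0 tpi] := angle_in_0pi R km; have /andP[t0' tpi'] := angle_in_0pi R km'.
rewrite pnatr_eq0 => /(_ isT) /cos_inj.
rewrite !in_itv /= !ltW // => /(_ isT isT).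
have mN0 : m%:R != 0 :> R by rewrite pnatr_eq0; lia.
move/(divIf mN0)/(mulIf (lt0r_neq0 (pi_gt0 R)))/eqP.
by rewrite eqr_nat => /eqP.
Qed.

Lemma equality_eigenvalueP (l : R) :
  equality_eigenvalue K d o l <-> 0 < l /\ laplacian_mult K d o l = 2%N.
Proof.
rewrite /equality_eigenvalue (theta_cycle hd hK hpure hF).
rewrite (pendant_number_cycle hd hK hpure hF) mulr1 addr0.
split=> [[l0 _ [?]] | [l0 rk]]; split=> //; last by rewrite rk.
by move: rk; rewrite /eigenvalue -mxrank_eq0 /laplacian_mult => ->.
Qed.

(** Both cases of the theorem are instances, with the even and the odd k
    respectively. *)
Lemma equality_spectrum (ks : seq nat) : uniq ks ->
  (forall k, k \in ks <-> (0 < k < m)%N /\ (-1) ^+ k = cycle_sign R K d o F) ->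
  let eigs := [seq cosine_eigenvalue k | k <- ks] in
  [/\ forall l : R, equality_eigenvalue K d o l <-> l \in eigs,
      uniq eigs &
      forall l : R, l \in eigs -> laplacian_mult K d o l = 2%N].
Proof.
move=> uks ksP eigs.
have eigsP l : l \in eigs -> 0 < l /\ laplacian_mult K d o l = 2%N.
  case/mapP => k /ksP[km ke] ->; have gt0 := cosine_eigenvalue_gt0 km.
  by split=> //; apply/laplacian_mult2P; [rewrite gt_eqF | exists k].
split=> [l | | l /eigsP[] //].
- split=> [/equality_eigenvalueP[l0] | /eigsP/equality_eigenvalueP //].
  case/(laplacian_mult2P (lt0r_neq0 l0)) => k [km ke ->].
  by apply: map_f; apply/ksP.
- rewrite map_inj_in_uniq // => k k' /ksP[km _] /ksP[km' _].
  exact: cosine_eigenvalue_inj.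
Qed.

End CycleSpectrum.

Lemma signr_eq1 (R : realType) k : (-1) ^+ k = 1 :> R <-> ~~ odd k.
Proof. by rewrite -signr_odd; case: odd; split=> //; rewrite ?expr1 ?expr0; lra. Qed.

Lemma signr_eqN1 (R : realType) k : (-1) ^+ k = -1 :> R <-> odd k.
Proof. by rewrite -signr_odd; case: odd; split=> //; rewrite ?expr1 ?expr0; lra. Qed.

Theorem corollary1 (R : realType) (V : finType) (K : {set {set V}}) (d : nat)
    (o : {set V} -> seq V) (m : nat) (F : 'I_m -> {set V})
    (hd : (1 <= d)%N)
    (hK : simplicial_complex K)
    (hcyc : simplicial_cycle K d)
    (ho : orientation K o)
    (hF : cyclic_facet_ordering K d F) :
  (cycle_sign R K d o F = 1 ->
    let eigs : seq R :=
      [seq d%:R + 1 + 2 * cos (2 * pi * j%:R / m%:R)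
         | j <- index_iota 1 (uphalf m)] in
    [/\ forall lambda : R, equality_eigenvalue K d o lambda <-> lambda \in eigs,
        uniq eigs &
        forall lambda : R, lambda \in eigs -> laplacian_mult K d o lambda = 2%N])
  /\
  (cycle_sign R K d o F = -1 ->
    let eigs : seq R :=
      [seq d%:R + 1 + 2 * cos ((2 * j + 1)%N%:R * pi / m%:R)
         | j <- index_iota 0 m./2] in
    [/\ forall lambda : R, equality_eigenvalue K d o lambda <-> lambda \in eigs,
        uniq eigs &
        forall lambda : R, lambda \in eigs -> laplacian_mult K d o lambda = 2%N]).
Proof.
have [hpure _ _] := hcyc.
split=> sgn eigs.
- have -> : eigs = [seq cosine_eigenvalue R d m k |
                      k <- [seq (2 * j)%N | j <- index_iota 1 (uphalf m)]].
    rewrite -map_comp; apply: eq_map => j /=.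
    by rewrite /cosine_eigenvalue natrM; congr (_ + 2 * cos (_ / _)); ring.
  apply: (equality_spectrum hd hK hpure ho hF).
    by rewrite map_inj_uniq ?iota_uniq // => j j'; lia.
  move=> k; rewrite sgn signr_eq1; split=> [/mapP[j] | [km ev]].
    rewrite mem_index_iota gtn_uphalf_double => jm ->.
    by split; lia.
  apply/mapP; exists k./2; last by lia.
  by rewrite mem_index_iota gtn_uphalf_double; lia.
- have -> : eigs = [seq cosine_eigenvalue R d m k |
                      k <- [seq (2 * j + 1)%N | j <- index_iota 0 m./2]].
    by rewrite -map_comp.
  apply: (equality_spectrum hd hK hpure ho hF).
    by rewrite map_inj_uniq ?iota_uniq // => j j'; lia.
  move=> k; rewrite sgn signr_eqN1; split=> [/mapP[j] | [km ev]].
    by rewrite mem_index_iota => jm ->; split; lia.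
  apply/mapP; exists k./2; last by lia.
  by rewrite mem_index_iota; lia.
Qed.
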